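(* Let $(\mu,\ell,\mathcal{W},\mathcal{A})$ be a learning tuple and let $n\ge 1$, with sample $\mathcal{S}_n=(Z_1,\dots,Z_n)$ i.i.d. from $\mu$ and output hypothesis $W$ of $\mathcal{A}$ on $\mathcal{S}_n$. Suppose that $r(W,Z)=\ell(W,Z)-\ell(w^*,Z)$ is $\sigma$-sub-Gaussian under the product distribution $P_W\otimes\mu$. Then $$\mathbb{E}_{W\mathcal{S}_n}\left[\mathcal{E}(W,\mathcal{S}_n)\right]\le \frac1n\sum_{i=1}^n\sqrt{2\sigma^2 I(W;Z_i)}.$$ Furthermore, $$\mathbb{E}_{W}\left[\mathcal{R}(W)\right]\le \mathbb{E}_{W\mathcal{S}_n}\left[\hat{\mathcal{R}}(W,\mathcal{S}_n)\right]+\frac1n\sum_{i=1}^n\sqrt{2\sigma^2 I(W;Z_i)}.$$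
   Context: Setting. $\mathcal{Z}$ is the instance space, $\mu$ a probability distribution on $\mathcal{Z}$, $\mathcal{W}$ the hypothesis space, $\ell:\mathcal{W}\times\mathcal{Z}\to\mathbb{R}$ a loss function. The sample $\mathcal{S}_n=(Z_1,\dots,Z_n)$ consists of i.i.d. draws from $\mu$. A (possibly randomised) algorithm $\mathcal{A}:\mathcal{Z}^n\to\mathcal{W}$, i.e. a conditional distribution $P_{W|\mathcal{S}_n}$, produces the hypothesis $W$. The tuple $(\mu,\ell,\mathcal{W},\mathcal{A})$ is called a learning tuple. $P_{W\mathcal{S}_n}$ is the induced joint law of $(W,\mathcal{S}_n)$, $P_{WZ_i}$ the induced joint law of $(W,Z_i)$, and $P_W$ the induced marginal law of $W$. Under $P_W\otimes\mu$, $W\sim P_W$ and $Z\sim\mu$ are independent. $\mathbb{E}_{W\mathcal{S}_n}$ and $\mathbb{E}_W$ denote expectation under $P_{W\mathcal{S}_n}$ and $P_W$. Definitions. $w^*\in\arg\min_{w\in\mathcal{W}}\mathbb{E}_{Z\sim\mu}[\ell(w,Z)]$ is an optimal hypothesis; $r(w,z)=\ell(w,z)-\ell(w^*,z)$. Generalization error: $\mathcal{E}(w,\mathcal{S}_n)=\mathbb{E}_{Z\sim\mu}[\ell(w,Z)]-\frac1n\sum_{i=1}^n\ell(w,Z_i)$. Excess risk: $\mathcal{R}(w)=\mathbb{E}_{Z\sim\mu}[\ell(w,Z)]-\mathbb{E}_{Z\sim\mu}[\ell(w^*,Z)]$. Empirical excess risk: $\hat{\mathcal{R}}(w,\mathcal{S}_n)=\frac1n\sum_{i=1}^n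 r(w,Z_i)$. $I(W;Z_i)=D(P_{WZ_i}\,\|\,P_W\otimes\mu)$ is the mutual information (KL divergence, natural logarithm). A random variable $X$ is $\sigma$-sub-Gaussian if $\log\mathbb{E}[e^{\eta(X-\mathbb{E}[X])}]\le \sigma^2\eta^2/2$ for all $\eta\in\mathbb{R}$. *)

(* Defs.v *)
From HB Require Import structures.
From mathcomp Require Import all_boot all_order all_algebra.
From mathcomp Require Import all_classical all_reals all_analysis.

Set Implicit Arguments.
Unset Strict Implicit.
Unset Printing Implicit Defensive.

Import Order.TTheory GRing.Theory Num.Theory.
Import numFieldNormedType.Exports.

Local Open Scope classical_set_scope.
Local Open Scope ring_scope.
Local Open Scope ereal_scope.
Local Open Scope charge_scope.

Section paired_rv.
Context d d1 d2 (T : measurableType d) (T1 : measurableType d1)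
  (T2 : measurableType d2).
Variables (X : {mfun T >-> T1}) (Y : {mfun T >-> T2}).

Definition pairRV (t : T) : T1 * T2 := (X t, Y t).

Let measurable_pairRV : measurable_fun [set: T] pairRV.
Proof. exact: measurable_fun_pair. Qed.

HB.instance Definition _ := isMeasurableFun.Build _ _ _ _ pairRV
  measurable_pairRV.

End paired_rv.

Section sample_rv.
Context d dZ (T : measurableType d) (Z : measurableType dZ) (n : nat).
Variable Zs : 'I_n -> {mfun T >-> Z}.

Definition sample (t : T) : n.-tuple Z := [tuple Zs i t | i < n].

Let measurable_sample : measurable_fun [set: T] sample.
Proof.
apply/measurable_fun_tnthP => i.
rewrite (_ : _ \o _ = Zs i)//.
by apply/funext => t /=; rewrite tnth_mktuple.
Qed.

HB.instance Definition _ := isMeasurableFun.Build _ _ _ _ sample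
  measurable_sample.

End sample_rv.

Section probabilistic_notions.
Context (R : realType).

Definition mutually_independent d dZ (T : measurableType d)
    (Z : measurableType dZ) (P : probability T R) (n : nat)
    (Zs : 'I_n -> {RV P >-> Z}) : Prop :=
  forall (J : {set 'I_n}) (A : 'I_n -> set Z),
    (forall i, measurable (A i)) ->
    P (\bigcap_(i in [set` J]) (Zs i @^-1` A i)) =
    \prod_(i in J) P (Zs i @^-1` A i).

Definition has_law d dZ (T : measurableType d) (Z : measurableType dZ)
    (P : probability T R) (X : {RV P >-> Z}) (mu : probability Z R) : Prop :=
  forall A, measurable A -> distribution P X A = mu A.

Definition iid d dZ (T : measurableType d) (Z : measurableType dZ)
    (P : probability T R) (n : nat) (Zs : 'I_n -> {RV P >-> Z})
    (mu : probability Z R) : Prop :=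
  mutually_independent Zs /\ forall i, has_law (Zs i) mu.

(* [k] is a version of the conditional distribution of [Y] given [X]. *)
Definition has_cond_law d dX dY (T : measurableType d) (TX : measurableType dX)
    (TY : measurableType dY) (P : probability T R) (Y : {RV P >-> TY})
    (X : {RV P >-> TX}) (k : R.-pker TX ~> TY) : Prop :=
  forall (B : set TY) (C : set TX), measurable B -> measurable C ->
    distribution P (pairRV Y X) (B `*` C) =
    \int[distribution P X]_(x in C) k x B.

(* Integrability makes ['E_P[X]] a finite number, so that [fine] is harmless;
   it is in any case implied by the bounds at [eta] and [- eta]. *)
Definition sub_gaussian d (T : measurableType d) (P : probability T R)
    (X : T -> R) (sigma : R) : Prop :=
  P.-integrable [set: T] (EFin \o X) /\
  forall eta : R,
    lne ('E_P[fun x => expR (eta * (X x - fine 'E_P[X]))%R]) <=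
    (sigma ^+ 2 * eta ^+ 2 / 2)%:E.

Definition KL d (T : measurableType d) (P Q : probability T R) : \bar R :=
  if `[< P `<< Q >] then
    \int[P]_x lne (('d (charge_of_finite_measure P) '/d Q) x)
  else +oo.

(* [mu] is meant to be the law of [Y]. *)
Definition mutual_info d d1 d2 (T : measurableType d) (T1 : measurableType d1)
    (T2 : measurableType d2) (P : probability T R) (mu : probability T2 R)
    (X : {RV P >-> T1}) (Y : {RV P >-> T2}) : \bar R :=
  KL (distribution P (pairRV X Y)) (distribution P X \x mu).

End probabilistic_notions.

Section learning.
Context (R : realType) dW dZ (W : measurableType dW) (Z : measurableType dZ).
Variables (mu : probability Z R) (l : W -> Z -> R).

(* Population quantities are extended-real: only an optimal hypothesis is
   required to have a finite risk. *)
Definition risk (w : W) : \bar R := \int[mu]_z (l w z)%:E.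

Definition optimal (w : W) : Prop := forall w', risk w <= risk w'.

Definition rel_loss (wstar w : W) (z : Z) : R := (l w z - l wstar z)%R.

Definition gen_error n (w : W) (s : n.-tuple Z) : \bar R :=
  risk w - (n%:R^-1 * \sum_(i < n) l w (tnth s i))%:E.

Definition excess_risk (wstar w : W) : \bar R := risk w - risk wstar.

Definition emp_excess_risk (wstar : W) n (w : W) (s : n.-tuple Z) : R :=
  (n%:R^-1 * \sum_(i < n) rel_loss wstar w (tnth s i))%R.

End learning.

Definition info_bound (R : realType) d dW dZ (T : measurableType d)
    (W : measurableType dW) (Z : measurableType dZ) (P : probability T R)
    (mu : probability Z R) (n : nat) (h : {RV P >-> W})
    (Zs : 'I_n -> {RV P >-> Z}) (sigma : R) : \bar R :=
  (n%:R^-1)%:E *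
  \sum_(i < n) sqrte ((2 * sigma ^+ 2)%:E * mutual_info mu h (Zs i)).

(* Main.v *)
(* A Donsker-Varadhan argument. Let P << Q with density p. From
   y - ln p <= expR (y - ln p) - 1 and the bound
   int_P (expR y / p) <= int_Q (expR y), one gets int_P y <= KL P Q whenever
   int_Q (expR y) <= 1. Taking y = eta (X - E_Q X) - sigma^2 eta^2 / 2 and
   optimising over eta yields |E_P X - E_Q X| <= sqrt (2 sigma^2 KL P Q), for X
   sigma-sub-Gaussian under Q. This is applied to X = r, Q = P_W \x mu and
   P = P_{W Z_i} and averaged over i; since r and l differ by the mu-integrable
   l(wstar, .), the expected generalization error is
   E_Q r - (1/n) sum_i E_{W Z_i} r, which is also the expected excess risk minus
   the expected empirical excess risk. *)
Require Import Defs.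
From HB Require Import structures.
From mathcomp Require Import all_boot all_order all_algebra.
From mathcomp Require Import all_classical all_reals all_analysis.
From mathcomp Require Import measurable_realfun ring lra.

Set Implicit Arguments.
Unset Strict Implicit.
Unset Printing Implicit Defensive.

Import Order.TTheory GRing.Theory Num.Theory.
Import numFieldNormedType.Exports.

Local Open Scope classical_set_scope.
Local Open Scope ring_scope.
Local Open Scope ereal_scope.

Lemma integral_probability_cst d (T : measurableType d) (R : realType)
    (P : probability T R) (c : R) : \int[P]_x c%:E = c%:E.
Proof. by rewrite integral_cst//= probability_setT mule1. Qed.

(** * Densities and the divergence as an integral of their logarithm *)

Section density.
Context d (T : measurableType d) (R : realType) (P Q : probability T R).
Hypothesis PQ : P `<< Q.

Let f := Radon_Nikodym_SigmaFinite.f P Q.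

(* Unlike ['d P '/d Q], this version of the density is nonnegative everywhere
   and not just almost everywhere. *)
Definition density (x : T) : R := fine (f x).

Let densityE x : (density x)%:E = f x.
Proof. by rewrite fineK// Radon_Nikodym_SigmaFinite.f_fin_num. Qed.

Lemma density_ge0 x : (0 <= density x)%R.
Proof. by rewrite -lee_fin densityE Radon_Nikodym_SigmaFinite.f_ge0. Qed.

Lemma measurable_density : measurable_fun setT density.
Proof.
apply/measurable_EFinP; rewrite (_ : EFin \o _ = f); last first.
  by apply/funext => x; rewrite /= densityE.
exact: measurable_int (Radon_Nikodym_SigmaFinite.f_integrable PQ).
Qed.

(** The [P]-mass of the zero set of the density is the integral over that set of the density
    itself. *)
Lemma ae_density_gt0 : {ae P, forall x, (0 < density x)%R}.
Proof.
have mA : measurable [set x | (density x <= 0)%R].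
  rewrite -[X in measurable X]setTI.
  by apply: measurable_fun_le => //; exact: measurable_density.
exists [set x | (density x <= 0)%R]; split => //; last first.
  by move=> x /= /negP; rewrite -leNgt.
rewrite (Radon_Nikodym_SigmaFinite.f_integral PQ)//.
apply: integral0_eq => x /= fx0; rewrite -/f -densityE; congr (_%:E).
by apply/eqP; rewrite eq_le fx0 density_ge0.
Qed.

(* Only an inequality: where the density vanishes, the left-hand side ignores
   the mass of [Q] (and [ln 0 = 0]). *)
Lemma integral_expR_sub_ln_density (g : T -> R) : measurable_fun setT g ->
  \int[P]_x (expR (g x - ln (density x)))%:E <= \int[Q]_x (expR (g x))%:E.
Proof.
move=> mg; have mln : measurable_fun setT (@ln R \o density).
  by apply: measurableT_comp; [exact: measurable_ln|exact: measurable_density].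
have me : measurable_fun setT (fun x => (expR (g x - ln (density x)))%:E).
  by apply/measurable_EFinP; apply: measurableT_comp => //;
    apply: measurable_funB.
rewrite -(Radon_Nikodym_SigmaFinite.change_of_variables PQ)//.
apply: ge0_le_integral => //=.
- by move=> x _; rewrite mule_ge0 ?lee_fin ?expR_ge0// -/f -densityE lee_fin
    density_ge0.
- apply: emeasurable_funM => //.
  exact: measurable_int (Radon_Nikodym_SigmaFinite.f_integrable PQ).
- by apply/measurable_EFinP; exact: measurableT_comp.
- move=> x _; rewrite -/f -densityE -EFinM lee_fin.
  have := density_ge0 x; rewrite le_eqVlt => /predU1P[<-|p0].
    by rewrite mulr0 expR_ge0.
  by rewrite expRD expRN lnK ?posrE// divfK// gt_eqF.
Qed.

(** The two versions of the derivative agree [Q]-a.e., hence [P]-a.e. by domination. Where the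
    density is positive, so [P]-a.e., [lne] and [ln] agree; at 0 they would not ([-oo] against
    0). *)
Lemma KL_density : KL P Q = \int[P]_x (ln (density x))%:E.
Proof.
rewrite /KL asboolT//; set q := Radon_Nikodym _ _.
have qfin x : q x \is a fin_num by exact: Radon_Nikodym_fin_num.
have mq : measurable_fun setT (fine \o q).
  by apply: measurableT_comp => //; apply: measurable_int;
    exact: Radon_Nikodym_integrable.
apply: ae_eq_integral => //.
- rewrite (_ : (fun _ => _) = fun x => if (fine (q x) <= 0)%R then -oo
      else (ln (fine (q x)))%:E); last first.
    by apply/funext => x; rewrite -[in LHS](fineK (qfin x)).
  apply: measurable_fun_ifT => //.
    exact: measurable_fun_ler.
  apply/measurable_EFinP; apply: measurableT_comp mq.
  exact: measurable_ln.
- apply/measurable_EFinP; apply: measurableT_comp; [exact: measurable_ln|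
    exact: measurable_density].
- have fq : ae_eq P setT f q.
    by apply: null_dominates_ae_eq PQ _ => //;
      exact: ae_eq_Radon_Nikodym_SigmaFinite.
  move: fq ae_density_gt0; apply: filterS2 => x /(_ I) fqx px _.
  by rewrite -fqx -densityE lne_EFin.
Qed.

End density.

(** * Change of measure under finite divergence *)

Section donsker_varadhan.
Context d (T : measurableType d) (R : realType) (P Q : probability T R).

Lemma KL_lty_dominates : KL P Q < +oo -> P `<< Q.
Proof. by rewrite /KL; case: asboolP. Qed.

Hypothesis KL_lty : KL P Q < +oo.

Let PQ : P `<< Q. Proof. exact: KL_lty_dominates. Qed.

Local Notation p := (density P Q).

Let measurable_ln_density : measurable_fun setT (fun x => ln (p x)).
Proof.
by apply: measurableT_comp; [exact: measurable_ln|exact: measurable_density].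
Qed.

Lemma integrable_expR_sub_ln_density (g : T -> R) : measurable_fun setT g ->
  \int[Q]_x (expR (g x))%:E < +oo ->
  P.-integrable setT (fun x => (expR (g x - ln (p x)))%:E).
Proof.
move=> mg goo; apply/integrableP; split.
  apply/measurable_EFinP; apply: measurableT_comp => //.
  exact: measurable_funB.
under eq_integral do rewrite gee0_abs ?lee_fin ?expR_ge0//.
exact: le_lt_trans (integral_expR_sub_ln_density PQ mg) goo.
Qed.

(** The negative part of [ln p] is at most [expR (- ln p)], whose [P]-integral is at most 1 (the
    case [g = 0]). A non-integrable positive part would then force [KL P Q = +oo]. *)
Lemma integrable_ln_density : P.-integrable setT (fun x => (ln (p x))%:E).
Proof.
set f := fun x => _.
have mf : measurable_fun setT f by exact/measurable_EFinP.
have iexpN : P.-integrable setT (fun x => (expR (0 - ln (p x)))%:E).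
  apply: integrable_expR_sub_ln_density => //.
  by rewrite expR0 integral_probability_cst ltry.
have ineg : P.-integrable setT f^\-.
  apply: le_integrable iexpN => //; first exact: measurable_funeneg.
  move=> x _; rewrite gee0_abs// gee0_abs ?lee_fin ?expR_ge0//.
  rewrite funenegE ge_max -EFinN !lee_fin expR_ge0 andbT.
  by rewrite (le_trans _ (expR_ge1Dx _))// sub0r lerDr.
have ipos : P.-integrable setT f^\+.
  apply/integrableP; split; first exact: measurable_funepos.
  under eq_integral do rewrite gee0_abs//.
  rewrite ltey; apply/eqP => fpos; move: KL_lty.
  rewrite KL_density// integralE -/f fpos addye//.
  by rewrite eqe_oppLR/= lt_eqF// integrable_lty.
by rewrite (_ : f = f^\+ \- f^\-); [exact: integrableB|exact: funeposneg].
Qed.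

Lemma KL_fin_num : KL P Q \is a fin_num.
Proof.
by rewrite KL_density//; exact: integrable_fin_num integrable_ln_density.
Qed.

(** Applying [1 + y <= expR y] to [g - ln p] and to [- g - ln p] dominates [|g|] by [|ln p|] plus
    the two exponentials, all [P]-integrable. *)
Lemma integrable_expR_KL (g : T -> R) : measurable_fun setT g ->
  \int[Q]_x (expR (g x))%:E < +oo -> \int[Q]_x (expR (- g x))%:E < +oo ->
  P.-integrable setT (EFin \o g).
Proof.
move=> mg goo Ngoo.
have i1 := integrable_expR_sub_ln_density mg goo.
have i2 : P.-integrable setT (fun x => (expR (- g x - ln (p x)))%:E).
  by apply: integrable_expR_sub_ln_density => //; exact: measurableT_comp.
have i3 := integrableD measurableT (integrable_abse integrable_ln_density)
  (integrableD measurableT i1 i2).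
apply: le_integrable i3 => //; first exact/measurable_EFinP.
move=> x _ /=; rewrite lee_fin.
rewrite [leRHS]ger0_norm ?addr_ge0 ?expR_ge0//.
have h1 := expR_ge1Dx (g x - ln (p x)).
have h2 := expR_ge1Dx (- g x - ln (p x)).
have h3 := ler_norm (ln (p x)).
have h4 := ler_norm (- ln (p x)); rewrite normrN in h4.
have h5 := expR_ge0 (g x - ln (p x)).
have h6 := expR_ge0 (- g x - ln (p x)).
by rewrite ler_norml; apply/andP; split; lra.
Qed.

Lemma integral_le_KL (g : T -> R) : P.-integrable setT (EFin \o g) ->
  \int[Q]_x (expR (g x))%:E <= 1 -> \int[P]_x (g x)%:E <= KL P Q.
Proof.
move=> ig g1; have mg : measurable_fun setT g.
  by apply/measurable_EFinP; exact: measurable_int ig.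
have ie : P.-integrable setT (fun x => (expR (g x - ln (p x)))%:E).
  apply: integrable_expR_sub_ln_density => //.
  exact: le_lt_trans g1 (ltry _).
have i1 : P.-integrable setT (cst 1%E).
  exact: finite_measure_integrable_cst.
apply: (@le_trans _ _ (\int[P]_x ((ln (p x))%:E +
    ((expR (g x - ln (p x)))%:E - 1)))).
  apply: le_integral => //.
    apply: integrableD => //; first exact: integrable_ln_density.
    exact: integrableB.
  move=> x _; rewrite -EFinB -EFinD lee_fin.
  by have := expR_ge1Dx (g x - ln (p x)); lra.
rewrite integralD//; [|exact: integrable_ln_density|exact: integrableB].
rewrite integralB// integral_probability_cst -KL_density//.
(* The correction term is the [P]-integral of [expR (g - ln p)] minus 1, which is nonpositive. *)
rewrite geeDl// sube_le0.
exact: le_trans (integral_expR_sub_ln_density PQ mg) g1.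
Qed.

(** [expeR] inverts [lne] on nonnegative extended reals, so the logarithmic bound exponentiates; in
    particular the moment generating function is finite. *)
Lemma sub_gaussian_mgf (X : T -> R) (sigma eta : R) : sub_gaussian Q X sigma ->
  \int[Q]_x (expR (eta * (X x - fine 'E_Q[X])))%:E <=
  (expR (sigma ^+ 2 * eta ^+ 2 / 2))%:E.
Proof.
move=> [_ /(_ eta)]; set m := fine _; rewrite unlock; set I := integral _ _ _.
move=> le_lne; rewrite -[leLHS]lneK.
  by rewrite -[leRHS]/(expeR _%:E) lee_expeR.
rewrite in_itv/= leey andbT /I.
by apply: integral_ge0 => x _; rewrite lee_fin expR_ge0.
Qed.

Lemma sub_gaussian_KL_integrable (X : T -> R) (sigma : R) :
  sub_gaussian Q X sigma -> P.-integrable setT (EFin \o X).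
Proof.
move=> subG; have [iX _] := subG.
set m := fine 'E_Q[X].
have mX : measurable_fun setT X.
  by apply/measurable_EFinP; exact: measurable_int iX.
(* The bounds at [eta = 1] and [eta = -1] supply the two exponential moments. *)
have iXm : P.-integrable setT (EFin \o (fun x => X x - m)%R).
  apply: integrable_expR_KL; first exact: measurable_funB.
  - have := sub_gaussian_mgf 1 subG; under eq_integral do rewrite mul1r.
    by move=> /le_lt_trans; apply; exact: ltry.
  - have := sub_gaussian_mgf (-1) subG; under eq_integral do rewrite mulN1r.
    by move=> /le_lt_trans; apply; exact: ltry.
have := integrableD measurableT iXm
  (finite_measure_integrable_cst P m measurableT).
by apply: eq_integrable => // x _ /=; rewrite -EFinD subrK.
Qed.

Lemma sub_gaussian_KL (X : T -> R) (sigma : R) : sub_gaussian Q X sigma ->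
  `|'E_P[X] - 'E_Q[X]| <= sqrte ((2 * sigma ^+ 2)%:E * KL P Q).
Proof.
move=> subG; have [iX _] := subG.
have iPX := sub_gaussian_KL_integrable subG.
have EQ : 'E_Q[X] \is a fin_num by rewrite unlock; exact: integrable_fin_num.
have EP : 'E_P[X] \is a fin_num by rewrite unlock; exact: integrable_fin_num.
set m := fine 'E_Q[X]; set a := fine 'E_P[X]; set K := fine (KL P Q).
have key eta : (eta * (a - m) - sigma ^+ 2 * eta ^+ 2 / 2 <= K)%R.
  set c := (sigma ^+ 2 * eta ^+ 2 / 2)%R.
  have ig : P.-integrable setT (EFin \o (fun x => eta * (X x - m) - c)%R).
    have i1 := finite_measure_integrable_cst P m measurableT.
    have i2 := finite_measure_integrable_cst P c measurableT.
    by have := integrableB measurableT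
      (integrableZl measurableT eta (integrableB measurableT iPX i1)) i2.
  have := integral_le_KL ig.
  have -> : \int[P]_x (eta * (X x - m) - c)%:E = (eta * (a - m) - c)%:E.
    under eq_integral do rewrite EFinB EFinM EFinB.
    rewrite integralB//; last 2 first.
    + apply: integrableZl => //; apply: integrableB => //.
      exact: finite_measure_integrable_cst.
    + exact: finite_measure_integrable_cst.
    rewrite integralZl//; last first.
      by apply: integrableB => //; exact: finite_measure_integrable_cst.
    rewrite integralB//; last exact: finite_measure_integrable_cst.
    rewrite !integral_probability_cst.
    by rewrite (_ : integral _ _ _ = a%:E)// fineK// unlock.
  rewrite -lee_fin /K (fineK KL_fin_num); apply.
  (* The factor [expR (- c)] comes out of the integral and cancels the sub-Gaussian bound
     [expR c]. *)
  under eq_integral do rewrite expRD EFinM.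
  rewrite ge0_integralZr//; last first.
    apply/measurable_EFinP; apply: measurableT_comp => //.
    apply: measurable_funM => //; apply: measurable_funB => //.
    exact/measurable_EFinP/(measurable_int _ iX).
  rewrite expRN; apply: le_trans (lee_wpmul2r _ (sub_gaussian_mgf eta subG)) _.
    by rewrite lee_fin invr_ge0 expR_ge0.
  by rewrite -EFinM divff// gt_eqF// expR_gt0.
have sq : ((a - m) ^+ 2 <= 2 * sigma ^+ 2 * K)%R.
  have [s0|s0] := eqVneq sigma 0%R.
    have [am|am] := eqVneq (a - m)%R 0%R.
      by rewrite am s0 !expr0n/= mulr0 mul0r.
    (* With [sigma = 0] the quadratic term vanishes, and this [eta] would give [K + 1 <= K]. *)
    have := key ((K + 1) / (a - m))%R.
    by rewrite divfK// s0 expr0n/= !mul0r subr0 gerDl ler10.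
  have s2 : (0 < sigma ^+ 2)%R by rewrite exprn_even_gt0.
  (* The maximiser of the left-hand side of [key] over [eta]. *)
  have := key ((a - m) / sigma ^+ 2)%R.
  rewrite (_ : _ - _ = (a - m) ^+ 2 / (2 * sigma ^+ 2))%R; last by field.
  have s22 : (0 < 2 * sigma ^+ 2)%R by rewrite mulr_gt0.
  by rewrite ler_pdivrMr// mulrC.
rewrite -(fineK EP) -(fineK EQ) -(fineK KL_fin_num) -/a -/m -/K /= lee_fin.
by rewrite -sqrtr_sqr ler_wsqrtr.
Qed.

End donsker_varadhan.

(** * Integrals under image laws and products, averages, measurability of the risk *)

Lemma integrable_distribution d1 d2 (T : measurableType d1)
    (T' : measurableType d2) (R : realType) (P : probability T R)
    (X : {RV P >-> T'}) (f : T' -> \bar R) :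
  (distribution P X).-integrable setT f -> P.-integrable setT (f \o X).
Proof.
move=> /integrableP[mf foo]; apply/integrableP; split.
  exact: measurableT_comp.
move: foo; rewrite ge0_integral_distribution//.
exact: measurableT_comp.
Qed.

(** Meant for [has_law], which compares two measures on measurable sets only. *)
Lemma eq_measure_integrable d (T : measurableType d) (R : realType)
    (m1 m2 : {measure set T -> \bar R}) (f : T -> \bar R) :
  (forall A, measurable A -> m1 A = m2 A) ->
  m2.-integrable setT f -> m1.-integrable setT f.
Proof.
move=> m12 /integrableP[mf foo]; apply/integrableP; split => //.
by rewrite (eq_measure_integral m2)// => A mA _; exact: m12.
Qed.

Lemma integrable_snd d1 d2 (T1 : measurableType d1) (T2 : measurableType d2)
    (R : realType) (P1 : probability T1 R) (P2 : probability T2 R)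
    (f : T2 -> \bar R) :
  P2.-integrable setT f -> (P1 \x P2).-integrable setT (fun x => f x.2).
Proof.
move=> /integrableP[mf foo]; apply/integrable12ltyP.
  exact: measurableT_comp.
by rewrite /= integral_cst//= probability_setT mule1.
Qed.

Lemma integral_snd d1 d2 (T1 : measurableType d1) (T2 : measurableType d2)
    (R : realType) (P1 : probability T1 R) (P2 : probability T2 R)
    (f : T2 -> \bar R) :
  P2.-integrable setT f -> \int[P1 \x P2]_x f x.2 = \int[P2]_y f y.
Proof.
move=> /(integrable_snd P1)/integral12_prod_meas1 <-.
by rewrite /fubini_F /= integral_cst//= probability_setT mule1.
Qed.

Lemma mule_average_cst (R : realType) (n : nat) (x : \bar R) :
  (1 <= n)%N -> x \is a fin_num -> (n%:R^-1)%:E * \sum_(i < n) x = x.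
Proof.
move=> n1 xfin; rewrite -(fineK xfin) sumEFin -EFinM sumr_const card_ord.
by rewrite -[X in (_ * X)%R]mulr_natl mulKf// pnatr_eq0 -lt0n.
Qed.

Section average.
Context d (T : measurableType d) (R : realType) (P : probability T R) (n : nat).
Variable F : 'I_n -> T -> R.
Hypothesis iF : forall i, P.-integrable setT (EFin \o F i).

Lemma integrable_average :
  P.-integrable setT (fun x => (n%:R^-1 * \sum_(i < n) F i x)%:E).
Proof.
have := integrableZl measurableT n%:R^-1
  (integrable_sum measurableT (index_enum 'I_n) (P := xpredT)
    (fun i _ => iF i)).
by apply: eq_integrable => // x _ /=; rewrite EFinM -sumEFin.
Qed.

Lemma integral_average :
  \int[P]_x (n%:R^-1 * \sum_(i < n) F i x)%:E =
  (n%:R^-1)%:E * \sum_(i < n) \int[P]_x (F i x)%:E.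
Proof.
under eq_integral do rewrite EFinM -sumEFin.
rewrite integralZl//; first by rewrite integral_sum.
by apply: integrable_sum => // i _; exact: iF.
Qed.

End average.

(** The risk may be infinite, so Tonelli is applied to the positive and negative parts of the loss
    separately. *)
Lemma measurable_risk (R : realType) (dW dZ : measure_display)
    (W : measurableType dW) (Z : measurableType dZ) (mu : probability Z R)
    (l : W -> Z -> R) :
  measurable_fun [set: W * Z] (fun x => l x.1 x.2) ->
  measurable_fun setT (risk mu l).
Proof.
move=> ml; pose f (x : W * Z) := (l x.1 x.2)%:E.
have mf : measurable_fun setT f by exact/measurable_EFinP.
rewrite (_ : risk mu l = fubini_F mu f^\+ \- fubini_F mu f^\-); last first.
  apply/funext => w; rewrite /risk integralE; congr (_ - _);
    by apply: eq_integral => z _; rewrite ?funeposE ?funenegE.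
by apply: emeasurable_funB; apply: measurable_fun_fubini_tonelli_F => //;
  [exact: measurable_funepos|exact: measurable_funeneg].
Qed.

(** * The averaged information bound *)

Section info_bound.
Context (R : realType) d dW dZ (T : measurableType d) (W : measurableType dW)
  (Z : measurableType dZ) (P : probability T R) (mu : probability Z R)
  (n : nat) (h : {RV P >-> W}) (Zs : 'I_n -> {RV P >-> Z}) (sigma : R).

(** If some information were infinite, [terms_def] would exclude [sigma = 0], so its term would be
    [+oo], and the other terms, being nonnegative, could not compensate. *)
Lemma info_bound_lty :
  (forall i, (2 * sigma ^+ 2)%:E *? mutual_info mu h (Zs i)) ->
  info_bound mu h Zs sigma < +oo -> forall i, mutual_info mu h (Zs i) < +oo.
Proof.
move=> terms_def; rewrite /info_bound => info_lty i.
(* The index [i] itself witnesses that [n] is positive. *)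
have n0 : (0 < n%:R^-1 :> R)%R by rewrite invr_gt0 ltr0n; case: (n) i => [[]|].
rewrite ltey; apply/eqP => Iy; move: info_lty (terms_def i).
rewrite (bigD1 i)//= Iy /mule_def/= => + c0.
have c_gt0 : (0 < 2 * sigma ^+ 2)%R.
  rewrite lt_neqAle mulr_ge0 ?sqr_ge0// andbT eq_sym.
  by apply: contraTneq c0 => ->; rewrite eqxx.
rewrite gt0_muley ?lte_fin//= addye ?gt0_muley ?lte_fin ?ltxx//.
by rewrite gt_eqF// (@lt_le_trans _ _ 0)// sume_ge0// => j _; exact: sqrte_ge0.
Qed.

(** The mean under the product law is written as an average of [n] copies of itself and compared
    index by index through one side of [sub_gaussian_KL]. *)
Lemma expectation_le_info_bound (X : W * Z -> R) : (1 <= n)%N ->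
  sub_gaussian (distribution P h \x mu) X sigma ->
  (forall i, mutual_info mu h (Zs i) < +oo) ->
  'E_(distribution P h \x mu)[X] <=
    (n%:R^-1)%:E * \sum_(i < n) 'E_(distribution P (pairRV h (Zs i)))[X] +
    info_bound mu h Zs sigma.
Proof.
move=> n1 subG Ilty.
pose Q : probability _ R := distribution P h \x mu.
pose Pi i : probability _ R := distribution P (pairRV h (Zs i)).
have KLi i : KL (Pi i) Q < +oo := Ilty i.
rewrite -/Q; under eq_bigr do rewrite -/(Pi _).
have EQ : 'E_Q[X] \is a fin_num.
  by rewrite unlock; apply: integrable_fin_num => //; case: subG.
have EP i : 'E_(Pi i)[X] \is a fin_num.
  have iX : (Pi i).-integrable setT (EFin \o X) :=
    sub_gaussian_KL_integrable (KLi i) subG.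
  by rewrite unlock; exact: integrable_fin_num.
rewrite /info_bound -muleDr//; last first.
  apply: fin_num_adde_defr; apply/sum_fin_numP => i _ _; exact: EP.
rewrite -big_split/= -[leLHS](mule_average_cst n1 EQ).
apply: lee_wpmul2l; first by rewrite lee_fin invr_ge0.
apply: lee_sum => i _; rewrite -leeBlDl//.
apply: le_trans (sub_gaussian_KL (KLi i) subG).
by rewrite -(fineK EQ) -(fineK (EP i)) lee_fin distrC ler_norm.
Qed.

End info_bound.

(** * Generalization error and excess risk *)

Theorem theorem2 (R : realType) (dO dW dZ : measure_display)
    (Omega : measurableType dO) (W : measurableType dW) (Z : measurableType dZ)
    (P : probability Omega R)
    (* learning tuple (mu, l, W, A) *)
    (n : nat) (n_ge1 : (1 <= n)%N)
    (mu : probability Z R) (l : W -> Z -> R)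
    (ml : measurable_fun [set: W * Z] (fun x => l x.1 x.2))
    (A : R.-pker (n.-tuple Z) ~> W)
    (* optimal hypothesis, with finite risk *)
    (wstar : W) (wstar_opt : optimal mu l wstar)
    (wstar_int : mu.-integrable [set: Z] (fun z => (l wstar z)%:E))
    (* i.i.d. sample and output hypothesis *)
    (Zs : 'I_n -> {RV P >-> Z}) (Zs_iid : iid Zs mu)
    (h : {RV P >-> W}) (h_output : has_cond_law h (sample Zs) A)
    (* sub-Gaussian relative loss *)
    (sigma : R)
    (r_subG : sub_gaussian (distribution P h \x mu)
                (fun x => rel_loss l wstar x.1 x.2) sigma)
    (* no term 2 sigma^2 I(W; Z_i) is of the undefined form 0 * oo *)
    (terms_def : forall i, (2 * sigma ^+ 2)%:E *? mutual_info mu h (Zs i)) :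
  \int[distribution P (pairRV h (sample Zs))]_x gen_error mu l x.1 x.2
    <= info_bound mu h Zs sigma
  /\
  (* the right-hand side is not of the undefined form (-oo) + oo *)
  ('E_(distribution P (pairRV h (sample Zs)))
      [fun x => emp_excess_risk l wstar x.1 x.2] +? info_bound mu h Zs sigma ->
   \int[distribution P h]_w excess_risk mu l wstar w
    <= 'E_(distribution P (pairRV h (sample Zs)))
          [fun x => emp_excess_risk l wstar x.1 x.2]
       + info_bound mu h Zs sigma).
Proof.
pose Q : probability _ R := distribution P h \x mu.
pose X (x : W * Z) := rel_loss l wstar x.1 x.2.
(* An infinite bound makes both claims trivial, the second because [+?] rules out [-oo + +oo]. *)
have [info_y|] := eqVneq (info_bound mu h Zs sigma) +oo.
  rewrite info_y; split => [|]; first exact: leey.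
  rewrite /adde_def eqxx/= andbT => emp_NNy.
  by rewrite addey ?leey//; move: emp_NNy; rewrite andbC; case: eqP.
rewrite -ltey => /(info_bound_lty terms_def) Ilty.
have {}subG : sub_gaussian Q X sigma := r_subG.
have key := expectation_le_info_bound n_ge1 subG Ilty.
pose Pi i : probability _ R := distribution P (pairRV h (Zs i)).
have iX : Q.-integrable setT (EFin \o X) by case: subG.
(* Expectations are pulled back to [Omega], where the summands for different [i] live on one
   space. *)
have ihX i : P.-integrable setT (fun t => (X (h t, Zs i t))%:E).
  have KLi : KL (Pi i) Q < +oo := Ilty i.
  exact: integrable_distribution (sub_gaussian_KL_integrable KLi subG).
have mX : measurable_fun setT X.
  by apply/measurable_EFinP; exact: measurable_int iX.
have EPi i : 'E_(Pi i)[X] = \int[P]_t (X (h t, Zs i t))%:E.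
  rewrite unlock; apply: integral_distribution; last exact: ihX.
  exact/measurable_EFinP.
have iwstar i : P.-integrable setT (fun t => (l wstar (Zs i t))%:E).
  have law_i : forall B, measurable B -> distribution P (Zs i) B = mu B.
    by case: Zs_iid => _; exact.
  exact: integrable_distribution (eq_measure_integrable law_i wstar_int).
have Ewstar i : \int[P]_t (l wstar (Zs i t))%:E = risk mu l wstar.
  rewrite /risk (eq_measure_integral (distribution P (Zs i))); last first.
    by move=> B mB _; apply/esym; case: Zs_iid => _; exact.
  rewrite integral_distribution//; last exact: iwstar.
  exact: measurable_int wstar_int.
have risk_fin : risk mu l wstar \is a fin_num by exact: integrable_fin_num.
(* Adding back the integrable [l wstar] transfers integrability and expectations from [X] to [l]. *)
have lE w z : (l w z = X (w, z) + l wstar z)%R by rewrite /X /rel_loss subrK.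
have il : Q.-integrable setT (fun x => (l x.1 x.2)%:E).
  have := integrableD measurableT iX
    (integrable_snd (distribution P h) wstar_int).
  by apply: eq_integrable => // -[w z] _ /=; rewrite [in RHS]lE.
(* The risk is the inner Fubini integral of [l] under [Q]. *)
have irisk : (distribution P h).-integrable setT (risk mu l).
  exact: integrable_fubini_F il.
have Erisk : \int[distribution P h]_w risk mu l w = 'E_Q[X] + risk mu l wstar.
  rewrite (integral12_prod_meas1 il) unlock.
  rewrite -[risk mu l wstar](integral_snd (distribution P h) wstar_int).
  rewrite -integralD//; last exact: integrable_snd wstar_int.
  by apply: eq_integral => -[w z] _ /=; rewrite [in LHS]lE.
have ihl i : P.-integrable setT (fun t => (l (h t) (Zs i t))%:E).
  have := integrableD measurableT (ihX i) (iwstar i).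
  by apply: eq_integrable => // t _ /=; rewrite [in RHS]lE.
have ihrisk : P.-integrable setT (fun t => risk mu l (h t)).
  exact: integrable_distribution irisk.
have EQ : 'E_Q[X] \is a fin_num by rewrite unlock; exact: integrable_fin_num.
have EPi_fin i : 'E_(Pi i)[X] \is a fin_num.
  by rewrite EPi; apply: integrable_fin_num => //; exact: ihX.
have avg_fin : (n%:R^-1)%:E * \sum_(i < n) 'E_(Pi i)[X] \is a fin_num.
  by rewrite fin_numM//; apply/sum_fin_numP => i _ _; exact: EPi_fin.
have EPhl i : \int[P]_t (l (h t) (Zs i t))%:E = 'E_(Pi i)[X] + risk mu l wstar.
  rewrite EPi -(Ewstar i) -integralD//.
  by apply: eq_integral => t _ /=; rewrite [in LHS]lE.
have mnth i : measurable_fun setT (fun x : W * n.-tuple Z => (x.1, tnth x.2 i)).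
  apply: measurable_fun_pair => //=.
  exact: measurableT_comp (measurable_tnth i) measurable_snd.
split.
  have gE t : gen_error mu l (h t) (sample Zs t) =
      risk mu l (h t) - (n%:R^-1 * \sum_(i < n) l (h t) (Zs i t))%:E.
    rewrite /gen_error; congr (_ - (_ * _)%:E).
    by apply: eq_bigr => i _; rewrite tnth_mktuple.
  have iavg := integrable_average ihl.
  rewrite integral_distribution/=; first last.
  - have := integrableB measurableT ihrisk iavg.
    by apply: eq_integrable => // t _ /=; rewrite gE.
  - apply: emeasurable_funB.
      apply: measurableT_comp; last exact: measurable_fst.
      exact: measurable_risk.
    apply/measurable_EFinP; apply: measurable_funM => //.
    apply: measurable_sum => i.
    exact: measurableT_comp ml (mnth i).
  under eq_integral do rewrite gE.
  rewrite integralB// integral_average//.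
  rewrite -(integral_distribution (measurable_int _ irisk) ihrisk) Erisk.
  (* The finite risk of [wstar] occurs in both means and cancels, which leaves [key]. *)
  under eq_bigr do rewrite EPhl.
  rewrite big_split/= muleDr//; last exact/fin_num_adde_defr/sum_fin_numP.
  rewrite mule_average_cst// fin_num_oppeD// addeACA subee// adde0.
  by rewrite leeBlDl.
have -> : 'E_(distribution P (pairRV h (sample Zs)))
    [fun x => emp_excess_risk l wstar x.1 x.2] =
    (n%:R^-1)%:E * \sum_(i < n) 'E_(Pi i)[X].
  have eE t : (emp_excess_risk l wstar (h t) (sample Zs t) =
      n%:R^-1 * \sum_(i < n) X (h t, Zs i t))%R.
    congr (_ * _)%R; apply: eq_bigr => i _.
    by rewrite tnth_mktuple.
  under [in RHS]eq_bigr do rewrite EPi.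
  rewrite -integral_average// unlock integral_distribution/=; first last.
  - have := integrable_average ihX.
    by apply: eq_integrable => // t _ /=; rewrite eE.
  - apply/measurable_EFinP; apply: measurable_funM => //.
    by apply: measurable_sum => i; exact: measurableT_comp mX (mnth i).
  by apply: eq_integral => t _; rewrite /= eE.
(* Removing the constant risk of [wstar] from [Erisk] leaves the left-hand side of [key]. *)
move=> _; rewrite /excess_risk integralB//; last first.
  by rewrite -(fineK risk_fin); exact: finite_measure_integrable_cst.
rewrite -[in X in _ - X](fineK risk_fin) integral_probability_cst fineK//.
by rewrite Erisk addeK.
Qed.
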